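(* Let $\mathcal A$ be a van Hove sequence in $G$. Let $f\in BL^2_{\mathcal A}(G)$ be such that for all $\chi\in\widehat G$ the Fourier–Bohr coefficient $a_\chi^{\mathcal A}(f)$ exists, and let $g\in Bap^2_{\mathcal A}(G)\cap L^\infty(G)$. Then the twisted Eberlein convolution $[f,g]_{\mathcal A}$ exists, $[f,g]_{\mathcal A}\in SAP(G)$, and for all $\chi\in\widehat G$ $$a_\chi^{\mathcal A}([f,g]_{\mathcal A})=a_\chi^{\mathcal A}(f)\,\overline{a_\chi^{\mathcal A}(g)}.$$
   Context: $G$ is a second countable, locally compact (Hausdorff) Abelian group with Haar measure $|\cdot|$ and dual group $\widehat G$. A van Hove sequence is a sequence $\mathcal A=(A_n)_{n\in\mathbb N}$ of precompact open subsets of $G$ (of positive measure) such that $\lim_{n}|\partial^K A_n|/|A_n|=0$ for each compact $K\subseteq G$, where for open $A$, $\partial^K A:=(\overline{A+K}\setminus A)\cup(((G\setminus A)-K)\cap\overline A)$. For measurable $f,g:G\to\mathbb C$, the twisted Eberlein convolution $[f,g]_{\mathcal A}$ is the function on $G$ given by $[f,g]_{\mathcal A}(t)=\lim_{n\to\infty}\frac1{|A_n|}\int_{A_n}f(s)\overline{g(s-t)}\,ds$; it is said to exist if this limit exists for all $t\in G$. For $f\in L^2_{\mathrm{loc}}(G)$, $\|f\|_{b,2,\mathcal A}=(\limsup_{n}\frac1{|A_n|}\int_{A_n}|f(t)|^2\,dt)^{1/2}$, and $BL^2_{\mathcal A}(G)=\{f\in L^2_{\mathrm{loc}}(G):\|f\|_{b,2,\mathcal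 A}<\infty\}$. $Bap^2_{\mathcal A}(G)$ (Besicovitch 2-almost periodic functions) is the closure in $BL^2_{\mathcal A}(G)$ of the set of trigonometric polynomials (finite linear combinations of characters) with respect to $\|\cdot\|_{b,2,\mathcal A}$. $SAP(G)$ is the set of bounded uniformly continuous functions $f$ such that the closure of the set of translates $\{f(\cdot-t):t\in G\}$ in the supremum norm is compact. The Fourier–Bohr coefficient of $f\in L^1_{\mathrm{loc}}(G)$ at $\chi\in\widehat G$ is $a_\chi^{\mathcal A}(f)=\lim_{n\to\infty}\frac1{|A_n|}\int_{A_n}f(s)\overline{\chi(s)}\,ds$, if the limit exists; it exists for all functions in $Bap^2_{\mathcal A}(G)$. *)

(* Defs.v *)
From HB Require Import structures.
From mathcomp Require Import all_boot all_order all_algebra complex.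
From mathcomp Require Import all_classical all_reals all_analysis ess_sup_inf.

Set Implicit Arguments.
Unset Strict Implicit.
Unset Printing Implicit Defensive.

Import Order.TTheory GRing.Theory Num.Theory.
Import numFieldNormedType.Exports.
Import ComplexField.Normc.

Local Open Scope classical_set_scope.
Local Open Scope ring_scope.
Local Open Scope complex_scope.

#[warnings="-redundant-canonical-projection"]
HB.instance Definition _ (R : realType) := NormedModule.copy R[i] R[i]^o.

(* Seen as a Zmodule, G is pointed (by 0), as measurableType demands. *)
Notation borel G := (@g_sigma_algebraType (GRing.Zmodule.sort G) (@open G)).

Section HaarMeasure.
Context {R : realType} {G : topologicalZmodType}.
Implicit Type mu : {measure set (borel G) -> \bar R}.
Local Open Scope ereal_scope.

(* Regularity is not required: on a second countable locally compact Hausdorff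
   space every Borel measure that is finite on compact sets is regular. *)
Definition haar_measure mu :=
  [/\ forall K : set G, compact K -> mu K < +oo,
      forall U : set G, open U -> U !=set0 -> 0 < mu U &
      forall (A : set (borel G)) (t : G), measurable A ->
        mu [set (x + t)%R | x in (A : set G)] = mu A].

End HaarMeasure.

Section VanHove.
Context {R : realType} {G : topologicalZmodType}.
Variable mu : {measure set (borel G) -> \bar R}.

Definition van_hove_boundary (K A : set G) : set G :=
  (closure [set x + y | x in A & y in K] `\` A) `|`
  ([set x - y | x in ~` A & y in K] `&` closure A).

Definition van_hove (A : nat -> set G) :=
  (forall n, [/\ open (A n), precompact (A n) & (0 < mu (A n))%E]) /\
  forall K : set G, compact K ->
    fine (mu (van_hove_boundary K (A n))) / fine (mu (A n)) @[n --> \oo] --> 0.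

End VanHove.

Section ComplexFunctions.
Context {R : realType} {G : topologicalZmodType}.
Variable mu : {measure set (borel G) -> \bar R}.
Implicit Types (D : set G) (f : G -> R[i]).

Definition cmeasurable f :=
  measurable_fun [set: borel G] (fun x => complex.Re (f x)) /\
  measurable_fun [set: borel G] (fun x => complex.Im (f x)).

Definition cintegrable D f :=
  mu.-integrable D (fun x => (complex.Re (f x))%:E) /\
  mu.-integrable D (fun x => (complex.Im (f x))%:E).

Definition cintegral D f : R[i] :=
  Complex (\int[mu]_(x in D) complex.Re (f x))
          (\int[mu]_(x in D) complex.Im (f x)).

Definition L2loc f := cmeasurable f /\
  forall K : set G, compact K ->
    (\int[mu]_(x in K) (normc (f x) ^+ 2)%:E < +oo)%E.

Definition Linfty f := cmeasurable f /\
  (ess_sup mu (fun x => (normc (f x))%:E) < +oo)%E.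

End ComplexFunctions.

Section Means.
Context {R : realType} {G : topologicalZmodType}.
Variables (mu : {measure set (borel G) -> \bar R}) (A : nat -> set G).
Implicit Types f g chi : G -> R[i].

Definition average f (n : nat) : R[i] :=
  ((fine (mu (A n)))^-1)%:C * cintegral mu (A n) f.

(* The integral is total, so the existence of a mean value also requires each
   of the integrals to be meaningful. *)
Definition mean_exists f :=
  (forall n, cintegrable mu (A n) f) /\ cvgn (average f).

Definition mean f : R[i] := limn (average f).

Definition eberlein_integrand f g (t s : G) : R[i] := f s * (g (s - t))^*.

Definition eberlein_exists f g :=
  forall t, mean_exists (eberlein_integrand f g t).

Definition eberlein f g (t : G) : R[i] := mean (eberlein_integrand f g t).

Definition fourier_bohr_exists f chi :=
  mean_exists (fun s => f s * (chi s)^*).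

Definition fourier_bohr f chi : R[i] := mean (fun s => f s * (chi s)^*).

End Means.

Section AlmostPeriodicity.
Context {R : realType} {G : topologicalZmodType}.
Implicit Types f chi : G -> R[i].

Definition character chi :=
  [/\ continuous chi, forall x, normc (chi x) = 1 &
      forall x y, chi (x + y) = chi x * chi y].

Definition trig_poly f :=
  exists (n : nat) (c : 'I_n -> R[i]) (chi : 'I_n -> G -> R[i]),
    (forall k, character (chi k)) /\
    f = (fun x => \sum_(k < n) c k * chi k x).

(* Uniform continuity is that of the translation uniformity of G, which
   topologicalZmodType does not carry as a structure; {uniform G -> R[i]} is
   the topology of uniform convergence, i.e., that of the supremum norm. *)
Definition SAP f :=
  [/\ exists M : R, forall x, normc (f x) <= M,
      forall e : R, 0 < e ->
        \forall u \near (0 : G), forall x, normc (f (x + u) - f x) < e &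
      compact (closure
        (range (fun t : G => (fun x => f (x - t)) : {uniform G -> R[i]})))].

Variables (mu : {measure set (borel G) -> \bar R}) (A : nat -> set G).

Definition b2norm f : \bar R :=
  (limn_esup (fun n => (fine (mu (A n)))^-1%:E *
     \int[mu]_(x in A n) (normc (f x) ^+ 2)%:E) `^ 2^-1)%E.

Definition BL2 f := L2loc mu f /\ (b2norm f < +oo)%E.

Definition Bap2 f := BL2 f /\
  forall e : R, 0 < e ->
    exists2 p, trig_poly p & (b2norm (fun x => f x - p x)%R < e%:E)%E.

End AlmostPeriodicity.

(* Main.v *)
(** By AM-GM, |f h| <= d |f|^2 + |h|^2 / d, so the averages of f against h are
    small as soon as the quadratic mean of h is. For h = g - p with p a
    trigonometric polynomial close to g, this stays true of every translate of
    h, uniformly in the translation: h is essentially bounded, and translating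
    A_n only adds mass inside a van Hove boundary. Since [f, chi] is
    a_chi(f) chi for a character chi, the function [f, g] is then a uniform
    limit of trigonometric polynomials, hence strongly almost periodic, and its
    Fourier-Bohr coefficients follow from the orthogonality of characters. *)

Require Import Defs.
From mathcomp Require Import all_boot all_order all_algebra complex.
From mathcomp Require Import all_classical all_reals all_analysis.
From mathcomp Require Import measurable_realfun ess_sup_inf ring lra.

Set Implicit Arguments.
Unset Strict Implicit.
Unset Printing Implicit Defensive.

Import Order.TTheory GRing.Theory Num.Theory.
Import numFieldNormedType.Exports.
Import ComplexField.Normc.

Local Open Scope classical_set_scope.
Local Open Scope ring_scope.
Local Open Scope complex_scope.

(** The weight d in the AM-GM bound is matched to the accuracy e: when the quadratic mean of h is
    below e^2, taking d = e makes both d |f|^2 and |h|^2 / d of order e on average. The index from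
    which the averages are small depends on t, but the bound does not, so uniformity in t holds for
    the limits, which is where it is needed. These limits are not known in advance: the values
    [f, p](t) for better and better p serve as Cauchy data. Compactness of the hull reduces to
    trigonometric polynomials, because translating one by t multiplies its coefficients by
    conj(chi_k(t)), points of the unit circle, which fall into finitely many small cells. For the
    coefficients, one and the same p approximates g in mean and, through [f, p], the function [f, g]
    uniformly; the coefficient of [f, p] at chi is exactly a_chi(f) conj(a_chi(p)). Orthogonality is
    itself a translation argument: moving by t multiplies the average of chi by conj(chi(t)), yet
    changes it by at most a multiple of a van Hove ratio. *)

Section ComplexNorm.
Context {R : realType}.
Implicit Types (x y z : R[i]) (a b c : R).

(** * The modulus of a complex number *)

Lemma normc_ge0 z : 0 <= normc z.
Proof. by case: z => a b; exact: sqrtr_ge0. Qed.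

Lemma ler_normcD x y : normc (x + y) <= normc x + normc y.
Proof. exact: le_normcD. Qed.

Lemma normc_opp x : normc (- x) = normc x.
Proof. exact: normcN. Qed.

Lemma ler_normcB x y : normc (x - y) <= normc x + normc y.
Proof. by rewrite -(normc_opp y) ler_normcD. Qed.

Lemma normc_distC x y : normc (x - y) = normc (y - x).
Proof. by rewrite -normc_opp opprB. Qed.

Lemma ler_normc_dist x y z : normc (x - z) <= normc (x - y) + normc (y - z).
Proof. by rewrite -[x - z](subrKA y) ler_normcD. Qed.

Lemma normc_real a : normc a%:C = `|a|.
Proof. by rewrite /normc /= expr0n addr0 sqrtr_sqr. Qed.

Lemma sqr_normcE z : normc z ^+ 2 = complex.Re z ^+ 2 + complex.Im z ^+ 2.
Proof. by case: z => a b /=; rewrite sqr_sqrtr ?addr_ge0 ?sqr_ge0. Qed.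

Lemma normc_conj z : normc z^* = normc z.
Proof. by case: z => a b /=; rewrite sqrrN. Qed.

Lemma Re_le_normc z : `|complex.Re z| <= normc z.
Proof.
rewrite -(@ler_pXn2r _ 2) ?nnegrE ?normc_ge0// sqr_normcE.
rewrite real_normK ?num_real//.
by rewrite lerDl sqr_ge0.
Qed.

Lemma Im_le_normc z : `|complex.Im z| <= normc z.
Proof.
rewrite -(@ler_pXn2r _ 2) ?nnegrE ?normc_ge0// sqr_normcE.
rewrite real_normK ?num_real//.
by rewrite lerDr sqr_ge0.
Qed.

Lemma normc_le_ReIm z : normc z <= `|complex.Re z| + `|complex.Im z|.
Proof.
rewrite -(@ler_pXn2r _ 2) ?nnegrE ?normc_ge0 ?addr_ge0// sqr_normcE sqrrD.
by rewrite !real_normK ?num_real// -addrA lerD2l lerDr mulrn_wge0// mulr_ge0.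
Qed.

Lemma normc_sum (I : finType) (F : I -> R[i]) :
  normc (\sum_i F i) <= \sum_i normc (F i).
Proof.
elim/big_ind2 : _ => [|x1 x2 y1 y2 h1 h2|i _].
- by rewrite normc0.
- by rewrite (le_trans (ler_normcD _ _))// lerD.
- by [].
Qed.

Lemma normc_lincomb_le (n : nat) (c : 'I_n -> R[i]) (a : 'I_n -> R[i]) (d : R) :
  (forall k, normc (a k) <= d) ->
  normc (\sum_(k < n) c k * a k) <= (\sum_(k < n) normc (c k)) * d.
Proof.
move=> ad; rewrite (le_trans (normc_sum _))// mulr_suml ler_sum// => k _.
by rewrite normcM ler_wpM2l// normc_ge0.
Qed.

Lemma Re_addc x y : complex.Re (x + y) = complex.Re x + complex.Re y.
Proof. by case: x; case: y. Qed.

Lemma Im_addc x y : complex.Im (x + y) = complex.Im x + complex.Im y.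
Proof. by case: x; case: y. Qed.

Lemma Re_mulc x y : complex.Re (x * y) =
  complex.Re x * complex.Re y - complex.Im x * complex.Im y.
Proof. by case: x; case: y. Qed.

Lemma Im_mulc x y : complex.Im (x * y) =
  complex.Re x * complex.Im y + complex.Im x * complex.Re y.
Proof. by case: x => ? ?; case: y => ? ? /=. Qed.

Lemma unimodular_conj z : normc z = 1 -> z * z^* = 1.
Proof.
move=> z1; apply/eqP; rewrite eq_complex; case: z z1 => a b.
move/(congr1 (fun r => r ^+ 2)); rewrite sqr_normcE/= => h; apply/andP; split.
  by rewrite mulrN opprK -!expr2 h expr1n.
by rewrite mulrN (mulrC b) addNr.
Qed.

End ComplexNorm.

(** * Complex limits through real radii and components *)

Section ComplexLimits.
Context {R : realType}.

(** In the partial order of [R[i]] a positive element has zero imaginary part, so complex radii are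
    real ones. *)
Lemma cvgcP {T : Type} {F : set_system T} {FF : Filter F} (u : T -> R[i])
    (l : R[i]) :
  u x @[x --> F] --> l <->
  forall e : R, 0 < e -> \forall x \near F, normc (l - u x) < e.
Proof.
split=> [/cvgrPdist_lt h e e0|h].
  have /h : (0 : R[i]) < e%:C by rewrite ltcR.
  by apply: filterS => x; rewrite ltcR.
apply/cvgrPdist_lt => -[a b]; rewrite ltcE/= => /andP[/eqP -> a0].
by apply: filterS (h _ a0) => x; rewrite -ltcR.
Qed.

Lemma cvgc_ReIm {T : Type} {F : set_system T} {FF : Filter F} (u : T -> R[i])
    (a b : R) :
  complex.Re (u x) @[x --> F] --> a -> complex.Im (u x) @[x --> F] --> b ->
  u x @[x --> F] --> a +i* b.
Proof.
move=> /cvgrPdist_lt ha /cvgrPdist_lt hb; apply/cvgcP => e e0.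
have e2 : 0 < e / 2 by rewrite divr_gt0.
apply: filterS2 (ha _ e2) (hb _ e2) => x xa xb.
apply: (le_lt_trans (normc_le_ReIm _)); rewrite [e]splitr.
by case: (u x) xa xb => ? ? /= xa xb; apply: ltrD.
Qed.

(** A Cauchy criterion: [l] depends on [e] and need not be the limit. Completeness of [R] is applied
    to the real and imaginary parts. *)
Lemma is_cvgc {T : Type} {F : set_system T} {FF : ProperFilter F}
    (u : T -> R[i]) :
  (forall e : R, 0 < e ->
    exists l : R[i], \forall x \near F, normc (u x - l) < e) ->
  cvg (u x @[x --> F]).
Proof.
move=> h.
have [ha hb] :
    cvg (complex.Re (u x) @[x --> F]) /\ cvg (complex.Im (u x) @[x --> F]).
  split; apply: cauchy_cvg; apply: cauchy_exP => e e0; have [l hl] := h _ e0.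
    exists (complex.Re l); apply: filterS hl => x /=; rewrite normc_distC.
    apply: le_lt_trans; rewrite (le_trans _ (Re_le_normc _))//.
    by case: l; case: (u x).
  exists (complex.Im l); apply: filterS hl => x /=; rewrite normc_distC.
  apply: le_lt_trans; rewrite (le_trans _ (Im_le_normc _))//.
  by case: l; case: (u x).
by apply/cvg_ex; eexists; exact: cvgc_ReIm ha hb.
Qed.

Lemma le_normc_lim {T : Type} {F : set_system T} {FF : ProperFilter F}
    (u : T -> R[i]) (l : R[i]) (c : R) :
  u x @[x --> F] --> l -> (\forall x \near F, normc (u x) <= c) ->
  normc l <= c.
Proof.
move=> /cvgcP ul uc; apply/ler_addgt0Pr => e e0.
have [x [xc xe]] := filter_ex (filterI uc (ul _ e0)).
by rewrite -[l](subrK (u x)) (le_trans (ler_normcD _ _))// addrC lerD// ltW.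
Qed.

End ComplexLimits.

(** * Compactness in the topology of uniform convergence *)

Section UniformCompactness.
Context {R : realType} {G : choiceType}.

Lemma nbhs_uniformcP (phi : {uniform G -> R[i]})
    (P : set {uniform G -> R[i]}) :
  nbhs phi P <-> exists2 e : R, 0 < e &
    [set h : {uniform G -> R[i]} | forall x, normc (phi x - h x) < e] `<=` P.
Proof.
rewrite uniform_nbhs; split=> [[E [entE EP]]|[e e0 eP]].
  move: entE; rewrite -entourage_ballE => -[[a b]] /=.
  rewrite ltcE/= => /andP[/eqP -> a0] sE; exists a => // h hP.
  by apply: EP => y _; apply: sE; rewrite /= -ball_normE /= ltcR.
exists [set xy : R[i] * R[i] | ball xy.1 e%:C xy.2]; split.
  by rewrite -entourage_ballE; exists e%:C => //=; rewrite ltcR.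
move=> h /= hE; apply: eP => x /=; have := hE x I.
by rewrite -ball_normE /= ltcR.
Qed.

Lemma ultra_finite_cover {T : Type} {I : finType} (U : set_system T)
    (B : I -> set T) :
  UltraFilter U -> U (\bigcup_i B i) -> exists i, U (B i).
Proof.
move=> UU UB; apply: contrapT => /forallNP nB.
have : U [set x | forall i, (~` B i) x].
  by apply: filter_forall => i; have [/nB|] := in_ultra_setVsetC (B i) UU.
by move=> /(filterI UB)/filter_ex[x [[i _ xi] /(_ i)]].
Qed.

(* By the finite covers, an ultrafilter contains arbitrarily small uniform
   balls, so it converges uniformly to its pointwise limit. *)
Lemma compact_closure_uniform {I : Type} (F : I -> {uniform G -> R[i]}) :
  (forall e : R, 0 < e -> exists (T : finType) (L : I -> T), forall i j,
    L i = L j -> forall x, normc (F i x - F j x) < e) ->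
  compact (closure (range F)).
Proof.
move=> finF; rewrite compact_ultra => U UU UF.
have small (e : R) : 0 < e -> exists h0 : {uniform G -> R[i]},
    U [set h : {uniform G -> R[i]} | forall x, normc (h x - h0 x) < e].
  move=> e0; have e3 : 0 < e / 3 by rewrite divr_gt0.
  have [T [L LF]] := finF _ e3.
  pose B k := [set h : {uniform G -> R[i]} |
    exists2 i, L i = k & forall x, normc (h x - F i x) < e / 3].
  have [k Uk] : exists k, U (B k).
    apply: ultra_finite_cover; apply: filterS UF => h.
    move=> /(_ [set h' | forall x, normc (h x - h' x) < e / 3])[].
      by apply/nbhs_uniformcP; exists (e / 3).
    by move=> _ [[i _ <-] hi]; exists (L i) => //; exists i.
  have [h0 [i Li hi]] := filter_ex Uk.
  exists h0; apply: filterS Uk => h [j Lj hj] x.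
  have := LF j i (etrans Lj (esym Li)) x; have := hi x; have := hj x.
  move=> a b c; have := ler_normc_dist (h x) (F j x) (h0 x).
  have := ler_normc_dist (F j x) (F i x) (h0 x).
  rewrite (normc_distC (F i x)); lra.
have ptw x : cvg ((h : {uniform G -> R[i]}) x @[h --> U]).
  apply: is_cvgc => e /small[h0 Uh0]; exists (h0 x).
  by apply: filterS Uh0 => h; exact.
pose phi : {uniform G -> R[i]} :=
  fun x => lim ((h : {uniform G -> R[i]}) x @[h --> U]).
have Uphi : U --> phi.
  move=> P /nbhs_uniformcP[e e0 eP]; have e3 : 0 < e / 3 by rewrite divr_gt0.
  have [h0 Uh0] := small _ e3; apply: filterS (Uh0) => h hh0; apply: eP => x /=.
  have : normc (phi x - h0 x) <= e / 3.
    apply: (@le_normc_lim _ _ U _ (fun h : {uniform G -> R[i]} => h x - h0 x)).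
      by apply: cvgB; [exact: ptw|exact: cvg_cst].
    by apply: filterS Uh0 => h' /(_ x)/ltW.
  have := hh0 x; have := ler_normc_dist (phi x) (h0 x) (h x).
  rewrite (normc_distC (h0 x)); lra.
exists phi; split => //; apply: closed_closure.
move=> P /Uphi UP; have [h [? ?]] := filter_ex (filterI UF UP).
by exists h.
Qed.

End UniformCompactness.

(** * Finite partitions of bounded families of numbers *)

Section FiniteLabels.
Context {R : realType}.

(** The label is the index of the cell of length [d] in [-M, M] containing the value. [N] is fixed
    before [I] and [r], so that one label type serves all components of a finite family. *)
Lemma finite_labels_real (M d : R) : 0 < d -> exists N : nat,
  forall (I : Type) (r : I -> R), (forall t, `|r t| <= M) ->
  exists L : I -> 'I_N.+1, forall t t', L t = L t' -> `|r t - r t'| < d.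
Proof.
move=> d0; exists (Num.truncn ((M + M) / d)) => I r rM.
have r0 t : 0 <= (r t + M) / d.
  by apply: divr_ge0; [have /ler_normlP[+ _] := rM t; lra|exact: ltW].
have rN t : (Num.truncn ((r t + M) / d) < (Num.truncn ((M + M) / d)).+1)%N.
  rewrite ltnS le_truncn// ler_pM2r ?invr_gt0// lerD2r.
  exact: le_trans (ler_norm _) (rM t).
exists (fun t => Ordinal (rN t)) => t t' [tt'].
have /andP[a b] := truncn_itv (r0 t).
have /andP[a' b'] := truncn_itv (r0 t').
rewrite tt' in a b; rewrite -natr1 in b b'.
have : `|(r t + M) / d - (r t' + M) / d| < 1.
  rewrite ltr_norml; apply/andP; split; lra.
rewrite -mulrBl normrM normfV (gtr0_norm d0) ltr_pdivrMr// mul1r.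
by rewrite opprD addrACA subrr addr0.
Qed.

Lemma finite_labels (K : finType) (M d : R) (I : Type) (c : K -> I -> R[i]) :
  0 < d -> (forall k t, normc (c k t) <= M) ->
  exists (T : finType) (L : I -> T), forall t t', L t = L t' ->
    forall k, normc (c k t - c k t') < d.
Proof.
move=> d0 cM; have d2 : 0 < d / 2 by rewrite divr_gt0.
have [N LN] := finite_labels_real M d2.
have /choice[L1 L1P] k := LN I (fun t => complex.Re (c k t))
  (fun t => le_trans (Re_le_normc _) (cM k t)).
have /choice[L2 L2P] k := LN I (fun t => complex.Im (c k t))
  (fun t => le_trans (Im_le_normc _) (cM k t)).
exists {ffun K -> 'I_N.+1 * 'I_N.+1}, (fun t => [ffun k => (L1 k t, L2 k t)]).
move=> t t' /ffunP tt' k; have := tt' k; rewrite !ffunE => -[/L1P h1 /L2P h2].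
apply: (le_lt_trans (normc_le_ReIm _)); rewrite [d]splitr.
by case: (c k t) h1 h2 => ? ?; case: (c k t') => ? ? /= h1 h2; apply: ltrD.
Qed.

End FiniteLabels.

(** * Algebra of characters *)

Section Characters.
Context {R : realType} {G : topologicalZmodType}.
Implicit Types (chi : G -> R[i]) (x y : G).

Lemma character0 chi : character chi -> chi 0 = 1.
Proof.
move=> [_ n1 cD]; have := cD 0 0; rewrite addr0 => /esym.
rewrite -[RHS]mulr1 => /mulfI; apply; apply: contra_eqN (n1 0) => /eqP ->.
by rewrite normc0 eq_sym oner_eq0.
Qed.

Lemma characterN chi x : character chi -> chi (- x) = (chi x)^*.
Proof.
move=> ch; have [_ n1 cD] := ch.
have := cD x (- x); rewrite subrr character0// => h.
by rewrite -[LHS]mul1r -(unimodular_conj (n1 x)) mulrAC -h mul1r.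
Qed.

Lemma characterB chi x y : character chi -> chi (x - y) = chi x * (chi y)^*.
Proof. by move=> ch; have [_ _ ->] := ch; rewrite characterN. Qed.

End Characters.

(** * Uniform limits of trigonometric polynomials *)

Section UniformLimits.
Context {R : realType} {G : topologicalZmodType}.

(** The uniform closure of the trigonometric polynomials; by the Bohr approximation theorem this is
    all of SAP(G), of which only the inclusion into [SAP] is proved below. *)
Definition trig_approximable (E : G -> R[i]) := forall e : R, 0 < e ->
  exists2 q : G -> R[i], trig_poly q & forall x, normc (E x - q x) <= e.

Lemma trig_poly_bounded (q : G -> R[i]) : trig_poly q ->
  exists M : R, forall x, normc (q x) <= M.
Proof.
move=> [n [c [chi [ch ->]]]]; exists ((\sum_(k < n) normc (c k)) * 1) => x.
by apply: normc_lincomb_le => // k; have [_ ->] := ch k.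
Qed.

(** The increment chi(x + u) - chi(x) = chi(x) (chi(u) - 1) has a modulus independent of x, so
    continuity of the characters at 0 is enough. *)
Lemma trig_poly_unif_cont (q : G -> R[i]) : trig_poly q ->
  forall e : R, 0 < e ->
  \forall u \near (0 : G), forall x, normc (q (x + u) - q x) < e.
Proof.
move=> [n [c [chi [ch ->]]]] e e0.
set S := \sum_(k < n) normc (c k).
have S0 : 0 <= S by apply: sumr_ge0 => k _; exact: normc_ge0.
(* The summand 1 keeps the denominator positive when all coefficients vanish and makes the final
   bound S e / (S + 1) strictly less than e. *)
have d0 : 0 < e / (S + 1) by rewrite divr_gt0// ltr_wpDl.
have : \forall u \near (0 : G), forall k, normc (chi k u - 1) < e / (S + 1).
  apply: filter_forall => k; have [cc _ _] := ch k.
  have /cvgcP/(_ _ d0) := cc 0; rewrite (character0 (ch k)).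
  by apply: filterS => u; rewrite normc_distC.
apply: filterS => u hu x.
have -> : \sum_(k < n) c k * chi k (x + u) - \sum_(k < n) c k * chi k x =
    \sum_(k < n) c k * (chi k x * (chi k u - 1)).
  rewrite -sumrB; apply: eq_bigr => k _; have [_ _ ->] := ch k.
  by rewrite mulrBr mulr1 mulrBr.
apply: (@le_lt_trans _ _ (S * (e / (S + 1)))).
  apply: normc_lincomb_le => // k; rewrite normcM.
  by have [_ -> _] := ch k; rewrite mul1r; exact/ltW/hu.
rewrite mulrCA -ltr_pdivlMl// mulVf ?gt_eqF// ltr_pdivrMr ?ltr_wpDl//.
by rewrite mul1r ltrDl.
Qed.

(** A translate by t depends on t only through the numbers conj(chi_k(t)), which have modulus 1.
    Equal labels mean that these numbers are close for every k. *)
Lemma trig_poly_labels (q : G -> R[i]) : trig_poly q -> forall e : R, 0 < e ->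
  exists (T : finType) (L : G -> T), forall t t', L t = L t' ->
    forall x, normc (q (x - t) - q (x - t')) < e.
Proof.
move=> [n [c [chi [ch ->]]]] e e0.
set S := \sum_(k < n) normc (c k).
have S0 : 0 <= S by apply: sumr_ge0 => k _; exact: normc_ge0.
have d0 : 0 < e / (S + 1) by rewrite divr_gt0// ltr_wpDl.
have [|T [L LP]] := @finite_labels _ _ 1 _ _ (fun k t => (chi k t)^*) d0.
  by move=> k t; rewrite normc_conj; have [_ -> _] := ch k.
exists T, L => t t' /LP tt' x.
have -> : \sum_(k < n) c k * chi k (x - t) - \sum_(k < n) c k * chi k (x - t') =
    \sum_(k < n) c k * (chi k x * ((chi k t)^* - (chi k t')^*)).
  rewrite -sumrB; apply: eq_bigr => k _; rewrite !(characterB _ _ (ch k)).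
  by rewrite !mulrBr.
apply: (@le_lt_trans _ _ (S * (e / (S + 1)))).
  apply: normc_lincomb_le => // k; rewrite normcM.
  by have [_ -> _] := ch k; rewrite mul1r; exact/ltW/tt'.
rewrite mulrCA -ltr_pdivlMl// mulVf ?gt_eqF// ltr_pdivrMr ?ltr_wpDl//.
by rewrite mul1r ltrDl.
Qed.

Lemma trig_approximable_unif_cont (E : G -> R[i]) : trig_approximable E ->
  forall e : R, 0 < e ->
  \forall u \near (0 : G), forall x, normc (E (x + u) - E x) < e.
Proof.
move=> EP e e0; have e4 : 0 < e / 4 by rewrite divr_gt0.
have [q qT Eq] := EP _ e4.
apply: filterS (trig_poly_unif_cont qT e4) => u hu x.
have := Eq x; have := Eq (x + u); have := hu x.
have := ler_normc_dist (E (x + u)) (q (x + u)) (E x).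
have := ler_normc_dist (q (x + u)) (q x) (E x).
rewrite (normc_distC (q x) (E x)); lra.
Qed.

Lemma trig_approximable_bounded (E : G -> R[i]) : trig_approximable E ->
  exists M : R, forall x, normc (E x) <= M.
Proof.
move=> /(_ 1 ltr01)[q /trig_poly_bounded[M qM] Eq]; exists (1 + M) => x.
by rewrite -[E x](subrK (q x)) (le_trans (ler_normcD _ _))// lerD.
Qed.

(** Continuity is what makes the convolution Borel measurable, so that its Fourier-Bohr integrals
    are meaningful. *)
Lemma trig_approximable_continuous (E : G -> R[i]) : trig_approximable E ->
  continuous E.
Proof.
move=> EP x; apply/cvgcP => e /(trig_approximable_unif_cont EP) h.
have : \forall y \near x, (forall z, normc (E (z + (y - x)) - E z) < e).
  have : (y - x) @[y --> x] --> (0 : G).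
    rewrite -(subrr x); apply: (@continuous_comp _ _ _ (fun y => (y, x))
      (fun z : G * G => z.1 - z.2)); last exact: sub_continuous.
    by apply: cvg_pair => //; exact: cvg_cst.
  by move/(_ _ h).
by apply: filterS => y /(_ x); rewrite [x + _]addrC subrK normc_distC.
Qed.

Lemma trig_approximable_SAP (E : G -> R[i]) : trig_approximable E -> SAP E.
Proof.
move=> EP; split.
- exact: trig_approximable_bounded.
- exact: trig_approximable_unif_cont.
apply: compact_closure_uniform => e e0.
have e4 : 0 < e / 4 by rewrite divr_gt0.
have [q qT Eq] := EP _ e4.
have [T [L LP]] := trig_poly_labels qT e4.
exists T, L => t t' /LP tt' x.
have := Eq (x - t); have := Eq (x - t'); have := tt' x.
have := ler_normc_dist (E (x - t)) (q (x - t)) (E (x - t')).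
have := ler_normc_dist (q (x - t)) (q (x - t')) (E (x - t')).
rewrite (normc_distC (q (x - t')) (E (x - t'))); lra.
Qed.

End UniformLimits.

(** * Borel measurability of complex functions and of translations *)

Section BorelMeasurability.
Context {R : realType} {G : topologicalZmodType}.
Implicit Types (U : set G) (f h : G -> R[i]).

Lemma open_borel U : open U -> measurable (U : set (borel G)).
Proof. by move=> oU; apply: sub_gen_smallest. Qed.

Lemma closed_borel U : closed U -> measurable (U : set (borel G)).
Proof.
by move=> cU; rewrite -[U]setCK; apply: measurableC; apply: open_borel;
  exact: closed_openC.
Qed.

Lemma continuous_borel (u : G -> R) :
  continuous u -> measurable_fun [set: borel G] (u : borel G -> R).
Proof.
move=> /continuousP cu; apply: (measurability _ (RGenOpens.measurableE R)).
move=> _ [_ [a [b ->]] <-]; rewrite setTI.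
by apply: open_borel; apply: cu; exact: interval_open.
Qed.

Lemma translation_continuous (t : G) : continuous (fun x : G => x - t).
Proof.
move=> x; apply: (@continuous_comp _ _ _ (fun y => (y, t))
  (fun z : G * G => z.1 - z.2)); last exact: sub_continuous.
by apply: cvg_pair => //; exact: cvg_cst.
Qed.

Lemma translation_borel (t : G) :
  measurable_fun [set: borel G] ((fun x : G => x - t) : borel G -> borel G).
Proof.
apply: (@measurability _ _ (borel G) (borel G) _ _ (@open G)) => //.
move=> _ [B oB <-]; rewrite setTI; apply: open_borel.
by move/continuousP : (@translation_continuous t); exact.
Qed.

Lemma cmeasurableD f h :
  cmeasurable f -> cmeasurable h -> cmeasurable (fun x => f x + h x).
Proof.
move=> [fr fi] [hr hi]; split.
- by under eq_fun do rewrite Re_addc; exact: measurable_funD.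
- by under eq_fun do rewrite Im_addc; exact: measurable_funD.
Qed.

Lemma cmeasurableM f h :
  cmeasurable f -> cmeasurable h -> cmeasurable (fun x => f x * h x).
Proof.
move=> [fr fi] [hr hi]; split.
- by under eq_fun do rewrite Re_mulc;
    apply: measurable_funB; exact: measurable_funM.
- by under eq_fun do rewrite Im_mulc;
    apply: measurable_funD; exact: measurable_funM.
Qed.

Lemma cmeasurable_cst (c : R[i]) : cmeasurable (fun _ : G => c).
Proof. by split; exact: measurable_cst. Qed.

Lemma cmeasurable_conj f : cmeasurable f -> cmeasurable (fun x => (f x)^*).
Proof.
have -> : (fun x => (f x)^*) = (fun x => complex.Re (f x) -i* complex.Im (f x)).
  by apply/funext => x; case: (f x).
by move=> [fr fi]; split => //=; exact: (measurable_funN fi).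
Qed.

Lemma cmeasurableB f h :
  cmeasurable f -> cmeasurable h -> cmeasurable (fun x => f x - h x).
Proof.
move=> mf mh; under eq_fun do rewrite -mulN1r.
by apply: cmeasurableD => //; apply: cmeasurableM => //; exact: cmeasurable_cst.
Qed.

Lemma cmeasurable_translate f (t : G) :
  cmeasurable f -> cmeasurable (fun x => f (x - t)).
Proof.
move=> [fr fi]; split.
- by apply: (measurableT_comp fr); exact: translation_borel.
- by apply: (measurableT_comp fi); exact: translation_borel.
Qed.

Lemma continuous_cmeasurable f : continuous f -> cmeasurable f.
Proof.
move=> cf; split; apply: continuous_borel => x; apply/cvgrPdist_lt => e e0;
  have /cvgcP/(_ _ e0) := cf x; apply: filterS => y; apply: le_lt_trans.
- by apply: le_trans (Re_le_normc _); case: (f x); case: (f y).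
- by apply: le_trans (Im_le_normc _); case: (f x); case: (f y).
Qed.

Lemma measurable_sqr_normc f : cmeasurable f ->
  measurable_fun [set: borel G] (fun x : borel G => normc (f x) ^+ 2).
Proof.
move=> [fr fi]; under eq_fun do rewrite sqr_normcE.
by apply: measurable_funD; exact: measurable_funX.
Qed.

End BorelMeasurability.

(** * The complex integral *)

Section ComplexIntegral.
Context {R : realType} {G : topologicalZmodType}.
Variable mu : {measure set (borel G) -> \bar R}.
Variable D : set G.
Hypothesis mD : measurable (D : set (borel G)).
Implicit Types (f h : G -> R[i]).

Lemma cintegrableD f h : cintegrable mu D f -> cintegrable mu D h ->
  cintegrable mu D (fun x => f x + h x).
Proof.
move=> [fr fi] [hr hi]; split.
- under eq_fun do rewrite Re_addc EFinD; exact: (integrableD mD fr hr).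
- under eq_fun do rewrite Im_addc EFinD; exact: (integrableD mD fi hi).
Qed.

Lemma cintegralD f h : cintegrable mu D f -> cintegrable mu D h ->
  cintegral mu D (fun x => f x + h x) = cintegral mu D f + cintegral mu D h.
Proof.
move=> [fr fi] [hr hi]; rewrite /cintegral.
under eq_Rintegral do rewrite Re_addc.
under [X in _ +i* X]eq_Rintegral do rewrite Im_addc.
by rewrite (RintegralD mD fr hr) (RintegralD mD fi hi).
Qed.

Lemma cintegrableZ (c : R[i]) f : cintegrable mu D f ->
  cintegrable mu D (fun x => c * f x).
Proof.
move=> [fr fi]; split.
- under eq_fun do rewrite Re_mulc EFinB !EFinM.
  by apply: (integrableB mD); exact: integrableZl.
- under eq_fun do rewrite Im_mulc EFinD !EFinM.
  by apply: (integrableD mD); exact: integrableZl.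
Qed.

Lemma cintegralZ (c : R[i]) f : cintegrable mu D f ->
  cintegral mu D (fun x => c * f x) = c * cintegral mu D f.
Proof.
move=> [fr fi]; rewrite /cintegral.
have rZ (k : R) (u : G -> R) : mu.-integrable D (fun x => (u x)%:E) ->
    mu.-integrable D (fun x => (k * u x)%:E).
  by move=> iu; under eq_fun do rewrite EFinM; exact: integrableZl.
under eq_Rintegral do rewrite Re_mulc.
under [X in _ +i* X]eq_Rintegral do rewrite Im_mulc.
rewrite (RintegralB mD (rZ _ _ fr) (rZ _ _ fi)).
rewrite (RintegralD mD (rZ _ _ fi) (rZ _ _ fr)).
rewrite !(RintegralZl _ mD fr) !(RintegralZl _ mD fi).
by case: c.
Qed.

Lemma cintegrable0 : cintegrable mu D (fun=> 0).
Proof. by split; exact: integrable0. Qed.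

Lemma cintegrable_dominated f (w : G -> R) : cmeasurable f ->
  mu.-integrable D (fun x => (w x)%:E) ->
  (forall x, D x -> `|complex.Re (f x)| <= w x /\ `|complex.Im (f x)| <= w x) ->
  cintegrable mu D f.
Proof.
move=> [fr fi] iw fw; split; apply: (le_integrable mD _ _ iw).
- by apply/measurable_EFinP/measurable_funTS.
- move=> x Dx; rewrite lee_fin (le_trans (fw x Dx).1)// ler_norm//.
- by apply/measurable_EFinP/measurable_funTS.
- move=> x Dx; rewrite lee_fin (le_trans (fw x Dx).2)// ler_norm//.
Qed.

Lemma integrable_cst_fin (M : R) : (mu D < +oo)%E ->
  mu.-integrable D (fun=> M%:E).
Proof.
move=> Dfin.
apply: (measurable_bounded_integrable mD Dfin (measurable_cst M)).
by exists `|M|; split; [exact: num_real|move=> r Mr x _; exact: ltW].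
Qed.

Lemma cintegrable_bounded f (M : R) : (mu D < +oo)%E -> cmeasurable f ->
  (forall x, normc (f x) <= M) -> cintegrable mu D f.
Proof.
move=> Dfin mf fM.
apply: (cintegrable_dominated mf (integrable_cst_fin M Dfin)).
by move=> x _; split; apply: le_trans (fM x);
  [exact: Re_le_normc|exact: Im_le_normc].
Qed.

(** The real and imaginary parts are bounded separately and added. This is the source of the factor
    2 in the constants below. *)
Lemma normc_cintegral_le f (w : G -> R) : cintegrable mu D f ->
  mu.-integrable D (fun x => (w x)%:E) ->
  (forall x, D x -> `|complex.Re (f x)| <= w x /\ `|complex.Im (f x)| <= w x) ->
  normc (cintegral mu D f) <= 2 * \int[mu]_(x in D) w x.
Proof.
move=> [fr fi] iw fw; apply: (le_trans (normc_le_ReIm _)) => /=.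
rewrite mulr2n mulrDl mul1r; apply: lerD;
  apply: (le_trans (le_normr_Rintegral mD _)) => //;
  apply: le_Rintegral => //; try exact: integrable_norm.
- by move=> x Dx; exact: (fw x Dx).1.
- by move=> x Dx; exact: (fw x Dx).2.
Qed.

End ComplexIntegral.

(** * From the seminorm to eventual bounds *)

Section LimSup.
Context {R : realType}.
Local Open Scope ereal_scope.

Lemma limn_esup_lt_near (u : (\bar R)^nat) (l : \bar R) :
  limn_esup u < l -> \forall n \near \oo, u n < l.
Proof.
move=> /ereal_inf_lt[_ [V FV <-] ul]; apply: filterS FV => n Vn.
by apply: le_lt_trans ul; apply: ereal_sup_ubound; exists n.
Qed.

Lemma poweR_half_lt (x : \bar R) (e : R) : (0 < e)%R ->
  x `^ 2^-1 < e%:E -> x < (e ^+ 2)%:E.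
Proof.
move=> e0 h; have [x0|x0] := ltP x 0.
  by rewrite (lt_le_trans x0)// lee_fin sqr_ge0.
rewrite ltNge; apply/negP => ex.
have : (e ^+ 2)%:E `^ 2^-1 <= x `^ 2^-1.
  by apply: gt0_ler_poweR => //;
    rewrite ?invr_ge0// in_itv/= ?leey ?andbT ?lee_fin ?sqr_ge0.
rewrite poweR12_sqrt ?lee_fin ?sqr_ge0//= sqrtr_sqr (gtr0_norm e0).
by rewrite leNgt h.
Qed.

End LimSup.

(** * Translations and van Hove boundaries *)

Section VanHoveMeans.
Context {R : realType} {G : topologicalZmodType}.
Hypothesis G_hausdorff : hausdorff_space G.
Variable mu : {measure set (borel G) -> \bar R}.
Hypothesis mu_haar : haar_measure mu.
Variable A : nat -> set G.
Hypothesis A_van_hove : van_hove mu A.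
Implicit Types (f h : G -> R[i]) (t : G) (n : nat) (u w : G -> R).

Lemma compact_borel (K : set G) : compact K -> measurable (K : set (borel G)).
Proof. by move=> cK; apply: closed_borel; exact: compact_closed. Qed.

Lemma van_hove_borel n : measurable (A n : set (borel G)).
Proof. by have [/(_ n)[oA _ _] _] := A_van_hove; exact: open_borel. Qed.

Lemma van_hove_compact_closure n : compact (closure (A n)).
Proof. by have [/(_ n)[_ + _] _] := A_van_hove; rewrite precompactE. Qed.

Lemma van_hove_finite n : (mu (A n) < +oo)%E.
Proof.
have [fin _ _] := mu_haar.
apply: le_lt_trans (fin _ (@van_hove_compact_closure n)).
apply: le_measure; rewrite ?inE;
  [exact: van_hove_borel| |exact: subset_closure].
exact: compact_borel (@van_hove_compact_closure n).
Qed.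

Lemma van_hove_measureE n : mu (A n) = (fine (mu (A n)))%:E.
Proof. by rewrite fineK// ge0_fin_numE// van_hove_finite. Qed.

Lemma van_hove_pos n : 0 < fine (mu (A n)).
Proof.
have [/(_ n)[_ _ An0] _] := A_van_hove.
by rewrite -lte_fin -van_hove_measureE.
Qed.

(** The sign is that of the substitution: the integral of u(x - t) over A_n is the integral of u
    over A_n - t. *)
Definition translate_boundary n t := van_hove_boundary [set - t] (A n).

(** Finiteness matters because [fine] sends +oo to 0: a van Hove ratio with an infinite numerator
    would carry no information. Here the boundary lies in the union of the compact sets closure(A_n)
    - t and closure(A_n). *)
Lemma translate_boundary_measure n t :
  measurable (translate_boundary n t : set (borel G)) /\
  (mu (translate_boundary n t) < +oo)%E.
Proof.
have cA := @van_hove_compact_closure n.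
have cTA : compact ((fun x => x - t) @` closure (A n)).
  by apply: continuous_compact => //; apply: continuous_subspaceT;
    exact: translation_continuous.
have sub : closure [set x + y | x in A n & y in [set - t]] `<=`
    (fun x => x - t) @` closure (A n).
  have /closure_id -> := compact_closed G_hausdorff cTA.
  apply: closureS => _ [x Ax [y -> <-]].
  by exists x => //; exact: subset_closure.
have mB : measurable (translate_boundary n t : set (borel G)).
  apply: measurableU.
    apply: measurableD; last exact: van_hove_borel.
    exact: closed_borel (@closed_closure _ _).
  apply: measurableI; last exact: closed_borel (@closed_closure _ _).
  rewrite (_ : [set x - y | x in ~` A n & y in [set - t]] =
      (fun x => x - t) @^-1` (~` A n)).
    have := @translation_borel G t measurableT _
      (measurableC (van_hove_borel n)).
    by rewrite setTI.
  apply/seteqP; split => [_ [x Ax [y -> <-]]|x Ax] /=.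
    by rewrite opprK addrK.
  by exists (x - t) => //; exists (- t) => //; rewrite opprK subrK.
split=> //; have [fin _ _] := mu_haar.
have mT := compact_borel cTA; have mc := compact_borel cA.
apply: (@le_lt_trans _ _
  (mu ((fun x => x - t) @` closure (A n) `|` closure (A n)))).
  apply: le_measure; rewrite ?inE//; first exact: measurableU.
  by move=> x [[/sub xA _]|[_ xA]]; [left|right].
by rewrite (le_lt_trans (measureU2 _ mT mc))// lte_add_pinfty// fin.
Qed.

Definition boundary_ratio t n :=
  fine (mu (translate_boundary n t)) / fine (mu (A n)).

Lemma boundary_ratio_cvg0 t : boundary_ratio t n @[n --> \oo] --> 0.
Proof. by have [_] := A_van_hove; apply; exact: compact_set1. Qed.

(** After the change of variables the domain is D = A_n - t, and D minus A_n is contained in the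
    first half of the boundary. The almost everywhere bound is used only after the substitution, for
    u itself, so no null set has to be translated. *)
Lemma integral_translate_le (u : G -> R) (M : R) n t :
  measurable_fun [set: borel G] (u : borel G -> R) -> (forall x, 0 <= u x) ->
  {ae mu, forall x : borel G, u x <= M} -> 0 <= M ->
  (\int[mu]_(x in A n) (u (x - t))%:E <=
   \int[mu]_(x in A n) (u x)%:E + M%:E * mu (translate_boundary n t))%E.
Proof.
move=> mu_u u0 uM M0.
pose phi : borel G -> borel G := fun x : G => x - t.
have mphi : measurable_fun [set: borel G] phi by exact: translation_borel.
have mue : measurable_fun [set: borel G] (fun x : borel G => (u x)%:E).
  exact/measurable_EFinP.
have mA := van_hove_borel n.
pose D : set (borel G) := [set x : G | A n (x + t)].
have mD : measurable D.
  have := @translation_borel G (- t) measurableT _ mA; rewrite setTI.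
  by rewrite /preimage; under eq_set do rewrite opprK.
have phiD : phi @^-1` D = A n.
  by apply/seteqP; split => x; rewrite /D /phi /= subrK.
have -> : (\int[mu]_(x in A n) (u (x - t))%:E = \int[mu]_(x in D) (u x)%:E)%E.
  rewrite -phiD -(@ge0_integral_pushforward _ _ _ _ _ _ mphi mu D
    (fun x : borel G => (u x)%:E) mD (measurable_funTS mue)); last first.
    by move=> x _; rewrite lee_fin.
  (* By translation invariance, [mu] is its own pushforward under [phi]. *)
  apply: eq_measure_integral => B mB _; rewrite /pushforward.
  have [_ _ inv] := mu_haar; rewrite -(inv _ t mB).
  congr (mu _); apply/seteqP; split => [x Bx|_ [x Bx <-]].
    by exists (x - t) => //; rewrite subrK.
  by rewrite /phi /= addrK.
have mDA : measurable (D `\` A n) by exact: measurableD.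
have := @ge0_subset_integral _ _ _ mu D (A n `|` (D `\` A n)) mD
  (measurableU _ _ mA mDA) (fun x => (u x)%:E).
move=> /(_ (measurable_funTS mue) (fun x _ => u0 x)) h.
apply: (le_trans (h _)).
  by move=> x Dx; have [Ax|nAx] := pselect (A n x); [left|right].
rewrite ge0_integral_setU//; last 3 first.
- exact: measurable_funTS.
- by move=> x _; rewrite lee_fin.
- by apply/disj_setPS => x [? []].
rewrite leeD2l//; apply: (@le_trans _ _ (\int[mu]_(x in D `\` A n) M%:E)%E).
  apply: ae_ge0_le_integral => //.
  - by move=> x _; rewrite lee_fin.
  - exact: measurable_funTS.
  - by apply: filterS uM => x xM _; rewrite lee_fin.
rewrite integral_cst// lee_wpmul2l ?lee_fin//.
have [mB _] := translate_boundary_measure n t.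
apply: le_measure; rewrite ?inE// => x [Dx nAx]; left; split => //.
apply: subset_closure; exists (x + t) => //.
by exists (- t) => //; rewrite addrK.
Qed.


(** * Averages over the van Hove sequence *)

Definition ravg n u := (fine (mu (A n)))^-1 * \int[mu]_(x in A n) u x.

Lemma integrable_ae_bounded u (M : R) n :
  measurable_fun [set: borel G] (u : borel G -> R) -> (forall x, 0 <= u x) ->
  {ae mu, forall x : borel G, u x <= M} -> 0 <= M ->
  mu.-integrable (A n) (fun x => (u x)%:E).
Proof.
move=> mu_u u0 uM M0; have mA := van_hove_borel n.
apply/integrableP; split; first exact/measurable_EFinP/measurable_funTS.
under eq_integral do rewrite gee0_abs ?lee_fin//.
apply: (@le_lt_trans _ _ (\int[mu]_(x in A n) M%:E)%E); last first.
  by rewrite integral_cst// van_hove_measureE -EFinM ltey.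
apply: ae_ge0_le_integral => //.
- by move=> x _; rewrite lee_fin.
- exact/measurable_EFinP/measurable_funTS.
- by apply: filterS uM => x xM _; rewrite lee_fin.
Qed.

(** Finiteness of the translated integral is read off from [integral_translate_le], whose right-hand
    side is finite. *)
Lemma integrable_ae_bounded_translate u (M : R) n t :
  measurable_fun [set: borel G] (u : borel G -> R) -> (forall x, 0 <= u x) ->
  {ae mu, forall x : borel G, u x <= M} -> 0 <= M ->
  mu.-integrable (A n) (fun x => (u (x - t))%:E).
Proof.
move=> mu_u u0 uM M0; have mA := van_hove_borel n.
have /integrableP[_ fin] := integrable_ae_bounded n mu_u u0 uM M0.
have [_ finB] := translate_boundary_measure n t.
apply/integrableP; split.
  apply/measurable_EFinP/measurable_funTS.
  by apply: (measurableT_comp mu_u); exact: translation_borel.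
under eq_integral do rewrite gee0_abs ?lee_fin//.
apply: (le_lt_trans (integral_translate_le n t mu_u u0 uM M0)).
apply: lte_add_pinfty; last first.
  by rewrite -(@fineK _ (mu _)) ?ge0_fin_numE// -EFinM ltey.
by move: fin; under eq_integral do rewrite gee0_abs ?lee_fin//.
Qed.

Lemma ravg_translate_le u (M : R) n t :
  measurable_fun [set: borel G] (u : borel G -> R) -> (forall x, 0 <= u x) ->
  {ae mu, forall x : borel G, u x <= M} -> 0 <= M ->
  ravg n (fun x => u (x - t)) <= ravg n u + M * boundary_ratio t n.
Proof.
move=> mu_u u0 uM M0; have mA := van_hove_borel n.
have [_ finB] := translate_boundary_measure n t.
have := integral_translate_le n t mu_u u0 uM M0.
have /(integrable_fin_num mA) h1 := integrable_ae_bounded n mu_u u0 uM M0.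
have /(integrable_fin_num mA) h2 :=
  integrable_ae_bounded_translate n t mu_u u0 uM M0.
rewrite -(fineK h1) -(fineK h2) -(@fineK _ (mu _)) ?ge0_fin_numE//.
rewrite -EFinM -EFinD lee_fin => h.
rewrite /ravg /boundary_ratio mulrA [M * _ / _]mulrC -mulrDr.
by rewrite ler_pM2l// invr_gt0 van_hove_pos.
Qed.

Lemma ravgD n u w : mu.-integrable (A n) (fun x => (u x)%:E) ->
  mu.-integrable (A n) (fun x => (w x)%:E) ->
  ravg n (fun x => u x + w x) = ravg n u + ravg n w.
Proof.
by move=> iu iw; rewrite /ravg (RintegralD (van_hove_borel n) iu iw) mulrDr.
Qed.

Lemma ravgZ n (c : R) u : mu.-integrable (A n) (fun x => (u x)%:E) ->
  ravg n (fun x => c * u x) = c * ravg n u.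
Proof.
by move=> iu; rewrite /ravg (RintegralZl _ (van_hove_borel n) iu) mulrCA.
Qed.

Lemma ravg_cst n (c : R) : ravg n (fun=> c) = c.
Proof.
rewrite /ravg Rintegral_cst; last exact: van_hove_borel.
by rewrite mulrCA mulVf ?mulr1// gt_eqF// van_hove_pos.
Qed.

Lemma averageD f h n : cintegrable mu (A n) f -> cintegrable mu (A n) h ->
  average mu A (fun x => f x + h x) n = average mu A f n + average mu A h n.
Proof.
by move=> cf ch; rewrite /average (cintegralD (van_hove_borel n) cf ch) mulrDr.
Qed.

Lemma averageZ (c : R[i]) f n : cintegrable mu (A n) f ->
  average mu A (fun x => c * f x) n = c * average mu A f n.
Proof.
by move=> cf; rewrite /average (cintegralZ (van_hove_borel n) _ cf) mulrCA.
Qed.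

Lemma averageE f n : average mu A f n =
  ravg n (fun x => complex.Re (f x)) +i* ravg n (fun x => complex.Im (f x)).
Proof. by rewrite /average /cintegral /ravg; simpc. Qed.

Lemma average_cst (c : R[i]) n : average mu A (fun=> c) n = c.
Proof. by rewrite averageE !ravg_cst; case: c. Qed.

Lemma cintegrable_lincomb (m : nat) (c : 'I_m -> R[i])
    (F : 'I_m -> G -> R[i]) n :
  (forall k, cintegrable mu (A n) (F k)) ->
  cintegrable mu (A n) (fun x => \sum_(k < m) c k * F k x) /\
  average mu A (fun x => \sum_(k < m) c k * F k x) n =
    \sum_(k < m) c k * average mu A (F k) n.
Proof.
have mA := van_hove_borel n.
elim: m => [|m IHm] in c F * => cF.
  under eq_fun do rewrite big_ord0.
  by rewrite big_ord0 average_cst; split => //; exact: cintegrable0.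
have [iS aS] := IHm (fun k => c (lift ord0 k)) _ (fun k => cF (lift ord0 k)).
under eq_fun do rewrite big_ord_recl.
rewrite big_ord_recl; split.
  by apply: cintegrableD => //; exact: cintegrableZ.
by rewrite averageD ?aS ?averageZ//; exact: cintegrableZ.
Qed.

Lemma normc_average_le f w n : cintegrable mu (A n) f ->
  mu.-integrable (A n) (fun x => (w x)%:E) ->
  (forall x, `|complex.Re (f x)| <= w x /\ `|complex.Im (f x)| <= w x) ->
  normc (average mu A f n) <= 2 * ravg n w.
Proof.
move=> cf iw fw; rewrite /average normcM normc_real normfV.
rewrite (gtr0_norm (van_hove_pos n)) /ravg mulrCA.
rewrite ler_pM2l ?invr_gt0 ?van_hove_pos//.
by apply: normc_cintegral_le => //; exact: van_hove_borel.
Qed.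

Lemma normc_average_bounded f (M : R) n : cmeasurable f ->
  (forall x, normc (f x) <= M) -> normc (average mu A f n) <= 2 * M.
Proof.
move=> mf fM; have mA := van_hove_borel n; have Afin := van_hove_finite n.
rewrite -(ravg_cst n M); apply: normc_average_le.
- exact: (cintegrable_bounded mA Afin mf fM).
- exact: integrable_cst_fin.
- by move=> x; split; apply: le_trans (fM x);
    [exact: Re_le_normc|exact: Im_le_normc].
Qed.

(* The one-sided estimate is applied to the nonnegative functions 1 + u and
   1 - u. *)
Lemma ravg_translate_bounded u n t :
  measurable_fun [set: borel G] (u : borel G -> R) -> (forall x, `|u x| <= 1) ->
  `|ravg n (fun x => u (x - t)) - ravg n u| <= 2 * boundary_ratio t n.
Proof.
move=> mu_u u1; have mA := van_hove_borel n; have Afin := van_hove_finite n.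
have iu (v : G -> R) : measurable_fun [set: borel G] (v : borel G -> R) ->
    (forall x, `|v x| <= 1) -> mu.-integrable (A n) (fun x => (v x)%:E).
  move=> mv v1; apply: (le_integrable mA _ _ (integrable_cst_fin mA 1 Afin)).
    exact/measurable_EFinP/measurable_funTS.
  by move=> x _; rewrite /= lee_fin normr1.
have ic := integrable_cst_fin mA 1 Afin.
have mut : measurable_fun [set: borel G] ((fun x => u (x - t)) : borel G -> R).
  by apply: (measurableT_comp mu_u); exact: translation_borel.
have iut := iu _ mut (fun x => u1 (x - t)).
have step (s : R) : `|s| = 1 ->
    s * (ravg n (fun x => u (x - t)) - ravg n u) <= 2 * boundary_ratio t n.
  move=> s1.
  have sZ (v : G -> R) : mu.-integrable (A n) (fun x => (v x)%:E) ->
      mu.-integrable (A n) (fun x => (s * v x)%:E).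
    by move=> iv; under eq_fun do rewrite EFinM; exact: integrableZl.
  have su x : `|s * u x| <= 1 by rewrite normrM s1 mul1r.
  have := @ravg_translate_le (fun x => 1 + s * u x) 2 n t.
  have iu' := iu _ mu_u u1; have isu := sZ _ iu'; have isut := sZ _ iut.
  rewrite !ravgD ?ravgZ ?ravg_cst//.
  rewrite -addrA lerD2l mulrBr lerBlDl; apply => //.
  - by apply: measurable_funD => //; exact: measurable_funM.
  - by move=> x; have := su x; rewrite ler_norml; lra.
  - by apply: aeW => x; have := su x; rewrite ler_norml; lra.
rewrite ler_norml; apply/andP; split.
  by have := step (-1); rewrite normrN1 => /(_ erefl); lra.
by have := step 1; rewrite normr1 => /(_ erefl); lra.
Qed.

(** * Averages of characters *)

Lemma character_cmeasurable (chi : G -> R[i]) :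
  character chi -> cmeasurable chi.
Proof. by move=> [cc _ _]; exact: continuous_cmeasurable. Qed.

Lemma character_cintegrable (chi : G -> R[i]) n :
  character chi -> cintegrable mu (A n) chi.
Proof.
move=> ch; apply: (@cintegrable_bounded _ _ _ _ (van_hove_borel n) _ 1).
- exact: van_hove_finite.
- exact: character_cmeasurable.
- by move=> x; have [_ -> _] := ch.
Qed.

(** The average of chi(x - t) is conj(chi(t)) times that of chi, and the two differ by
    O([boundary_ratio]). Hence (conj(chi(t)) - 1) times the average tends to 0, and the factor is
    nonzero. The 4 collects 2 for each of the real and imaginary parts. *)
Lemma average_character_cvg0 (chi : G -> R[i]) t :
  character chi -> chi t <> 1 -> average mu A chi n @[n --> \oo] --> 0.
Proof.
move=> ch cht; have [_ n1 _] := ch.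
pose d := normc ((chi t)^* - 1).
have d0 : 0 < d.
  rewrite lt_neqAle normc_ge0 andbT eq_sym; apply/eqP => /eq0_normc/subr0_eq.
  by move/(congr1 conjc); rewrite conjcK conjc1.
have bound n : normc (average mu A chi n) <= 4 / d * boundary_ratio t n.
  rewrite mulrAC ler_pdivlMr// mulrC -normcM mulrBl mul1r.
  rewrite -averageZ; last exact: character_cintegrable.
  under [X in average _ _ X _]eq_fun do rewrite mulrC -characterB//.
  rewrite !averageE (le_trans (normc_le_ReIm _))//.
  have [mr mi] := character_cmeasurable ch.
  have n1' x : normc (chi x) <= 1 by rewrite n1.
  have hr := @ravg_translate_bounded _ n t mr
    (fun x => le_trans (Re_le_normc _) (n1' x)).
  have hi := @ravg_translate_bounded _ n t mi
    (fun x => le_trans (Im_le_normc _) (n1' x)).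
  by rewrite /=; move: hr hi => /=; lra.
apply/cvgcP => e e0.
have /cvgrPdist_lt/(_ _ (divr_gt0 e0 (divr_gt0 (ltr0n _ 4) d0))) :=
  boundary_ratio_cvg0 t.
apply: filterS => n; rewrite !sub0r normrN normc_opp => h.
apply: (le_lt_trans (bound n)); rewrite mulrC -ltr_pdivlMr ?divr_gt0//.
exact: le_lt_trans (ler_norm _) h.
Qed.

(** * Quadratic means and the smallness of the error term *)

Definition msq n h := ravg n (fun x => normc (h x) ^+ 2).

(** Integrability is asked on each [A n], where the averages are taken; [L2loc] provides it since
    the closure of [A n] is compact. *)
Definition locally_sqr_integrable h := cmeasurable h /\
  forall n, mu.-integrable (A n) (fun x => (normc (h x) ^+ 2)%:E).

Definition ess_bounded h := exists2 M : R,
  0 <= M & {ae mu, forall x : borel G, normc (h x) <= M}.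

Lemma L2loc_sqr_integrable h : L2loc mu h -> locally_sqr_integrable h.
Proof.
move=> [mh hK]; split => // n.
have cA := @van_hove_compact_closure n.
apply: (integrableS _ (van_hove_borel n) (@subset_closure _ (A n)));
  first exact: compact_borel.
apply/integrableP; split.
  by apply/measurable_EFinP/measurable_funTS; exact: measurable_sqr_normc.
under eq_integral do rewrite gee0_abs ?lee_fin ?sqr_ge0//.
exact: hK.
Qed.

Lemma Linfty_ess_bounded h : Linfty mu h -> ess_bounded h.
Proof.
move=> [_]; have := ess_sup_ge mu (fun x => (normc (h x))%:E).
case: (ess_sup mu _) => [r hr _|//|hr _].
- exists `|r| => //; apply: filterS hr => x; rewrite lee_fin.
  move=> /le_trans; apply; exact: ler_norm.
(* If the essential supremum is -oo, almost every point satisfies an impossible inequality, so any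
   bound will do. *)
- by exists 0 => //; apply: filterS hr => x; rewrite leeNy_eq.
Qed.

Lemma ess_boundedB h k : ess_bounded h ->
  (exists M : R, forall x, normc (k x) <= M) ->
  ess_bounded (fun x => h x - k x).
Proof.
move=> [M M0 hM] [N kN]; exists (M + N).
  by rewrite addr_ge0// (le_trans (normc_ge0 (k 0))).
by apply: filterS hM => x xM; rewrite (le_trans (ler_normcB _ _))// lerD.
Qed.

Lemma sqr_normc_bounded h (M : R) :
  {ae mu, forall x : borel G, normc (h x) <= M} ->
  {ae mu, forall x : borel G, normc (h x) ^+ 2 <= M ^+ 2}.
Proof.
apply: filterS => x xM; rewrite ler_pXn2r ?nnegrE ?normc_ge0//.
by apply: le_trans xM; exact: normc_ge0.
Qed.

Lemma ess_bounded_sqr_integrable h : cmeasurable h -> ess_bounded h ->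
  locally_sqr_integrable h.
Proof.
move=> mh [M M0 hM]; split => // n.
apply: (@integrable_ae_bounded _ (M ^+ 2)); rewrite ?sqr_ge0//.
- exact: measurable_sqr_normc.
- by move=> x; rewrite sqr_ge0.
- exact: sqr_normc_bounded.
Qed.

Lemma translate_sqr_integrable h t : cmeasurable h -> ess_bounded h ->
  locally_sqr_integrable (fun x => h (x - t)).
Proof.
move=> mh [M M0 hM]; split; first exact: cmeasurable_translate.
move=> n; apply: (@integrable_ae_bounded_translate
  (fun x => normc (h x) ^+ 2) (M ^+ 2)); rewrite ?sqr_ge0//.
- exact: measurable_sqr_normc.
- by move=> x; rewrite sqr_ge0.
- exact: sqr_normc_bounded.
Qed.

Lemma b2norm_lt_near h (e : R) : locally_sqr_integrable h -> 0 < e ->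
  (b2norm mu A h < e%:E)%E -> \forall n \near \oo, msq n h < e ^+ 2.
Proof.
move=> [_ ih] e0 /(poweR_half_lt e0)/limn_esup_lt_near; apply: filterS => n.
have := integrable_fin_num (van_hove_borel n) (ih n) => /fineK <-.
by rewrite -EFinM lte_fin.
Qed.

Lemma b2norm_lty_near h : locally_sqr_integrable h ->
  (b2norm mu A h < +oo)%E ->
  exists2 C : R, 0 < C & \forall n \near \oo, msq n h <= C.
Proof.
move=> ih; have := poweR_ge0 _ _ : (0 <= b2norm mu A h)%E.
case E : (b2norm mu A h) => [r| |]// r0 _.
have r1 : 0 < r + 1 by rewrite ltr_wpDl.
exists ((r + 1) ^+ 2); first by rewrite exprn_gt0.
have : (b2norm mu A h < (r + 1)%:E)%E by rewrite E lte_fin ltrDl.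
by move/(b2norm_lt_near ih r1); apply: filterS => n /ltW.
Qed.

(** The free weight [d] takes the place of the Cauchy-Schwarz inequality: a single pointwise
    majorant yields both the integrability of the product and the estimate of its average. *)
Lemma average_prod_conj f k n (d : R) : 0 < d ->
  locally_sqr_integrable f -> locally_sqr_integrable k ->
  cintegrable mu (A n) (fun s => f s * (k s)^*) /\
  normc (average mu A (fun s => f s * (k s)^*) n) <=
    2 * (d * msq n f + d^-1 * msq n k).
Proof.
move=> d0 [mf /(_ n) iF] [mk /(_ n) ik].
have mA := van_hove_borel n.
have mfk : cmeasurable (fun s => f s * (k s)^*).
  by apply: cmeasurableM => //; exact: cmeasurable_conj.
have iZ (c : R) (u : G -> R) : mu.-integrable (A n) (fun x => (u x)%:E) ->
    mu.-integrable (A n) (fun x => (c * u x)%:E).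
  by move=> iu; under eq_fun do rewrite EFinM; exact: integrableZl.
have iw : mu.-integrable (A n)
    (fun x => (d * normc (f x) ^+ 2 + d^-1 * normc (k x) ^+ 2)%:E).
  by under eq_fun do rewrite EFinD; apply: (integrableD mA); exact: iZ.
(* AM-GM: 2 a b <= d a^2 + b^2 / d *)
have amgm x : normc (f x * (k x)^*) <=
    d * normc (f x) ^+ 2 + d^-1 * normc (k x) ^+ 2.
  rewrite normcM normc_conj; set a := normc (f x); set b := normc (k x).
  have ab : 0 <= a * b by rewrite mulr_ge0 ?normc_ge0.
  have : 0 <= d^-1 * (d * a - b) ^+ 2.
    by rewrite mulr_ge0 ?sqr_ge0// invr_ge0 ltW.
  have -> : d^-1 * (d * a - b) ^+ 2 = d * a ^+ 2 + d^-1 * b ^+ 2 - 2 * (a * b).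
    by field; rewrite gt_eqF.
  lra.
have dom x : `|complex.Re (f x * (k x)^*)| <=
      d * normc (f x) ^+ 2 + d^-1 * normc (k x) ^+ 2 /\
    `|complex.Im (f x * (k x)^*)| <=
      d * normc (f x) ^+ 2 + d^-1 * normc (k x) ^+ 2.
  by split; apply: le_trans (amgm x); [exact: Re_le_normc|exact: Im_le_normc].
have cfk := cintegrable_dominated mA mfk iw (fun x _ => dom x).
split=> //; apply: (le_trans (normc_average_le cfk iw dom)).
by rewrite ravgD ?ravgZ//; exact: iZ.
Qed.

(** With weight d = e the bound is 2 (e C + q / e), where q is the quadratic mean of the translate
    of h. The boundary adds at most e^2 to that of h, so q <= 2 e^2 eventually, which gives 2 (C +
    2) e. *)
Lemma eberlein_small f h (C e : R) : 0 < e -> locally_sqr_integrable f ->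
  (\forall n \near \oo, msq n f <= C) -> cmeasurable h -> ess_bounded h ->
  (\forall n \near \oo, msq n h < e ^+ 2) -> forall t,
  (forall n, cintegrable mu (A n) (eberlein_integrand f h t)) /\
  \forall n \near \oo,
    normc (average mu A (eberlein_integrand f h t) n) <= 2 * (C + 2) * e.
Proof.
move=> e0 sf fC mh bh he t; have sh := translate_sqr_integrable t mh bh.
split=> [n|]; first by have [] := average_prod_conj n e0 sf sh.
have [M M0 hM] := bh.
(* The boundary ratio is taken below e^2 / (M^2 + 1), the 1 covering the case M = 0. *)
have M1 : 0 < M ^+ 2 + 1 by rewrite ltr_wpDl// sqr_ge0.
have := boundary_ratio_cvg0 t => /cvgrPdist_lt.
move=> /(_ _ (divr_gt0 (exprn_gt0 2 e0) M1)) brt.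
apply: filterS3 fC he brt => n fC he; rewrite sub0r normrN.
move=> /(le_lt_trans (ler_norm _)); rewrite ltr_pdivlMr// => brt.
have [_ /le_trans] := average_prod_conj n e0 sf sh; apply.
rewrite -mulrA ler_pM2l// mulrDl [C * e]mulrC lerD//.
  by rewrite ler_pM2l.
rewrite ler_pdivrMl//.
have := @ravg_translate_le (fun x => normc (h x) ^+ 2) (M ^+ 2) n t
  (measurable_sqr_normc mh) (fun x => sqr_ge0 _) (sqr_normc_bounded hM)
  (sqr_ge0 _).
have br0 : 0 <= boundary_ratio t n.
  by rewrite divr_ge0// fine_ge0// measure_ge0.
rewrite /msq in he *; rewrite !expr2 in he brt *; nra.
Qed.

(** * Trigonometric polynomials: convolution with f and Fourier-Bohr coefficients *)

Lemma trig_poly_continuous (m : nat) (c : 'I_m -> R[i])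
    (chi : 'I_m -> G -> R[i]) : (forall k, character (chi k)) ->
  continuous (fun x => \sum_(k < m) c k * chi k x).
Proof.
move=> ch; apply: trig_approximable_continuous => e e0.
exists (fun x => \sum_(k < m) c k * chi k x); first by exists m, c, chi.
by move=> x; rewrite subrr normc0 ltW.
Qed.

Lemma cvg_sum_scale (m : nat) (c : 'I_m -> R[i]) (u : 'I_m -> nat -> R[i])
    (l : 'I_m -> R[i]) :
  (forall k, u k n @[n --> \oo] --> l k) ->
  (\sum_(k < m) c k * u k n) @[n --> \oo] --> \sum_(k < m) c k * l k.
Proof.
elim: m => [|m IHm] in c u l * => ul.
  under eq_fun do rewrite big_ord0.
  by rewrite big_ord0; exact: cvg_cst.
under eq_fun do rewrite big_ord_recl.
rewrite big_ord_recl; apply: cvgD; last by apply: IHm => k; exact: ul.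
by apply: cvgMr; exact: ul.
Qed.

(** Since conj(chi(s - t)) = chi(t) conj(chi(s)), the variable t factors out of each average,
    leaving those that define the Fourier-Bohr coefficients of f. *)
Lemma cvg_eberlein_trig f (m : nat) (c : 'I_m -> R[i])
    (chi : 'I_m -> G -> R[i]) (t : G) :
  (forall k, fourier_bohr_exists mu A f (chi k)) ->
  (forall k, character (chi k)) ->
  let F := eberlein_integrand f (fun x => \sum_(k < m) c k * chi k x) t in
  (forall n, cintegrable mu (A n) F) /\
  average mu A F n @[n --> \oo] -->
    \sum_(k < m) ((c k)^* * fourier_bohr mu A f (chi k)) * chi k t.
Proof.
move=> fch ch F.
have FE : F = (fun s => \sum_(k < m) ((c k)^* * chi k t) * (f s * (chi k s)^*)).
  apply/funext => s; rewrite /F /eberlein_integrand rmorph_sum mulr_sumr.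
  apply: eq_bigr => k _; rewrite rmorphM (characterB _ _ (ch k)) rmorphM/=.
  transitivity (f s * ((c k)^* * ((chi k s)^* * chi k t))); last by ring.
  by congr (_ * (_ * (_ * _))); exact: conjcK.
have lin n := cintegrable_lincomb (fun k => (c k)^* * chi k t)
  (fun k => (fch k).1 n).
split=> [n|]; first by rewrite FE; exact: (lin n).1.
rewrite FE; under eq_fun do rewrite (lin _).2.
under eq_bigr do rewrite mulrAC.
by apply: cvg_sum_scale => k; exact: (fch k).2.
Qed.

Lemma character_prod_conj (chi psi : G -> R[i]) :
  character chi -> character psi -> character (fun s => chi s * (psi s)^*).
Proof.
move=> ch ps; have [cc n1 cD] := ch; have [pc m1 pD] := ps; split.
- move=> x; apply: cvgM; first exact: cc.
  apply/cvgcP => e e0; have /cvgcP/(_ _ e0) := pc x.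
  by apply: filterS => y; rewrite -rmorphB normc_conj.
- by move=> x; rewrite normcM normc_conj n1 m1 mulr1.
- by move=> x y; rewrite cD pD rmorphM mulrACA.
Qed.

(** For chi different from psi, the character chi conj(psi) takes a value other than 1 at some t,
    and its averages vanish in the limit. *)
Lemma average_character_orthogonal (chi psi : G -> R[i]) :
  character chi -> character psi ->
  average mu A (fun s => chi s * (psi s)^*) n @[n --> \oo] -->
    (`[< chi = psi >]%:R : R[i]).
Proof.
move=> ch ps; have [e|ne] := pselect (chi = psi).
  rewrite asboolT// -e.
  have -> : (fun s => chi s * (chi s)^*) = (fun=> 1).
    by apply/funext => s; rewrite unimodular_conj//; have [_ ->] := ch.
  by under eq_fun do rewrite average_cst; exact: cvg_cst.
rewrite asboolF//.
have [t chit] : exists t, chi t <> psi t.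
  by apply: contrapT => /forallNP h; apply: ne; apply/funext => t;
    exact: contrapT.
apply: (@average_character_cvg0 _ t); first exact: character_prod_conj.
move=> h; apply: chit; have [_ n1 _] := ps.
by rewrite -[LHS]mulr1 -(unimodular_conj (n1 t)) mulrCA h mulr1.
Qed.

Lemma cvg_trig_fourier_bohr (m : nat) (c : 'I_m -> R[i])
    (chi : 'I_m -> G -> R[i]) (psi : G -> R[i]) :
  (forall k, character (chi k)) -> character psi ->
  average mu A (fun s => (\sum_(k < m) c k * chi k s) * (psi s)^*) n
    @[n --> \oo] --> \sum_(k < m) c k * (`[< chi k = psi >]%:R : R[i]).
Proof.
move=> ch ps.
have -> : (fun s => (\sum_(k < m) c k * chi k s) * (psi s)^*) =
    (fun s => \sum_(k < m) c k * (chi k s * (psi s)^*)).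
  by apply/funext => s; rewrite mulr_suml; apply: eq_bigr => k _; rewrite mulrA.
have lin n := cintegrable_lincomb c (fun k =>
  character_cintegrable n (character_prod_conj (ch k) ps)).
under eq_fun do rewrite (lin _).2.
by apply: cvg_sum_scale => k; exact: average_character_orthogonal.
Qed.

(** [K] is fixed before [e], while [l] and [v] may change with [e]. Used at e / (K + 1), the two
    errors add up to e. *)
Lemma cvg_approx (u : nat -> R[i]) (K : R) : 0 <= K ->
  (forall e : R, 0 < e -> exists l : R[i], exists2 v : nat -> R[i],
    v n @[n --> \oo] --> l &
    \forall n \near \oo, normc (u n - v n) <= K * e) ->
  cvgn u.
Proof.
move=> K0 h; apply: is_cvgc => e e0.
have K1 : 0 < K + 1 by rewrite ltr_wpDl.
have [l [v vl uv]] := h _ (divr_gt0 e0 K1); exists l.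
have /cvgcP/(_ _ (divr_gt0 e0 K1)) := vl.
apply: filterS2 uv => n uv vn.
apply: (le_lt_trans (ler_normc_dist _ (v n) _)); rewrite (normc_distC (v n)).
apply: (lt_le_trans (ler_ltD uv vn)).
by rewrite -[X in _ + X]mul1r -mulrDl mulrCA divff ?mulr1// gt_eqF.
Qed.

Lemma le_normc_limB (u v : nat -> R[i]) (l : R[i]) (c : R) :
  cvgn u -> v n @[n --> \oo] --> l ->
  (\forall n \near \oo, normc (u n - v n) <= c) -> normc (limn u - l) <= c.
Proof.
move=> cu vl uv; have h : (u - v) @ \oo --> limn u - l by exact: (cvgB cu vl).
exact: (le_normc_lim h uv).
Qed.

(** * Existence, approximation and coefficients of the convolution *)

Section Main.
Variables f g : G -> R[i].
Hypothesis f_BL2 : BL2 mu A f.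
Hypothesis f_fourier_bohr :
  forall chi, character chi -> fourier_bohr_exists mu A f chi.
Hypothesis g_Bap2 : Bap2 mu A g.
Hypothesis g_Linfty : Linfty mu g.

(** This is [f, p] for p the sum of the c_k chi_k, by [cvg_eberlein_trig]. *)
Definition eberlein_trig (m : nat) (c : 'I_m -> R[i])
    (chi : 'I_m -> G -> R[i]) (t : G) : R[i] :=
  \sum_(k < m) ((c k)^* * fourier_bohr mu A f (chi k)) * chi k t.

(** The polynomial is chosen before t, and K depends on neither e nor t; only [v] and the threshold
    in n vary with t. The data on [h] are kept in the conclusion so that the coefficients of g can
    be computed from the same polynomial. *)
Lemma eberlein_approx : exists2 K : R, 0 < K & forall e : R, 0 < e ->
  exists (m : nat) (c : 'I_m -> R[i]) (chi : 'I_m -> G -> R[i]),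
    let h := fun x => g x - \sum_(k < m) c k * chi k x in
    [/\ forall k, character (chi k), locally_sqr_integrable h,
        \forall n \near \oo, msq n h < e ^+ 2 &
        forall t, (forall n, cintegrable mu (A n) (eberlein_integrand f g t)) /\
          exists2 v : nat -> R[i], v n @[n --> \oo] --> eberlein_trig c chi t &
          \forall n \near \oo,
            normc (average mu A (eberlein_integrand f g t) n - v n) <= K * e].
Proof.
have [fL2 fb] := f_BL2; have sf := L2loc_sqr_integrable fL2.
have [C C0 fC] := b2norm_lty_near sf fb.
have [[gL2 _] gap] := g_Bap2.
(* The constant of [eberlein_small], with C an eventual bound for the quadratic means of f. *)
exists (2 * (C + 2)) => [|e e0]; first by rewrite mulr_gt0// addr_gt0.
have [_ [m [c [chi [ch ->]]]] b2h] := gap _ e0.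
exists m, c, chi => h.
have cp := trig_poly_continuous (c := c) ch.
have mh : cmeasurable h.
  by apply: cmeasurableB; [exact: g_Linfty.1|exact: continuous_cmeasurable].
have bh : ess_bounded h.
  apply: ess_boundedB (Linfty_ess_bounded g_Linfty) _.
  by apply: trig_poly_bounded; exists m, c, chi.
have sh := ess_bounded_sqr_integrable mh bh.
have he := b2norm_lt_near sh e0 b2h.
split=> // t; have [ih nh] := eberlein_small e0 sf fC mh bh he t.
have [ip vp] := cvg_eberlein_trig c t (fun k => f_fourier_bohr (ch k)) ch.
set p := (fun x => \sum_(k < m) c k * chi k x) in ip vp.
have gE : eberlein_integrand f g t =
    (fun s => eberlein_integrand f p t s + eberlein_integrand f h t s).
  apply/funext => s; rewrite /eberlein_integrand -mulrDr -rmorphD/=.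
  by congr (_ * (_)^*); rewrite /h /p [RHS]addrC subrK.
rewrite gE; split.
- by move=> n; apply: cintegrableD => //; exact: van_hove_borel.
- exists (average mu A (eberlein_integrand f p t)) => //.
  by apply: filterS nh => n; rewrite averageD// [X in X - _]addrC addrK.
Qed.

Lemma eberlein_existence : eberlein_exists mu A f g.
Proof.
have [K K0 approx] := eberlein_approx => t; split.
  (* The integrability statement does not involve e, so any accuracy provides it. *)
  by have [m [c [chi [_ _ _ /(_ t)[]]]]] := approx 1 ltr01.
apply: (@cvg_approx _ K); first exact: ltW.
move=> e /approx[m [c [chi [_ _ _ /(_ t)[_ [v vl vK]]]]]].
by exists (eberlein_trig c chi t); exists v.
Qed.

Lemma eberlein_trig_close (K e : R) (m : nat) (c : 'I_m -> R[i])
    (chi : 'I_m -> G -> R[i]) (t : G) :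
  (exists2 v : nat -> R[i], v n @[n --> \oo] --> eberlein_trig c chi t &
    \forall n \near \oo,
      normc (average mu A (eberlein_integrand f g t) n - v n) <= K * e) ->
  normc (eberlein mu A f g t - eberlein_trig c chi t) <= K * e.
Proof.
move=> [v vl vK]; exact: (le_normc_limB (eberlein_existence t).2 vl vK).
Qed.

Lemma eberlein_trig_poly (m : nat) (c : 'I_m -> R[i])
    (chi : 'I_m -> G -> R[i]) :
  (forall k, character (chi k)) -> trig_poly (eberlein_trig c chi).
Proof.
by move=> ch; exists m, (fun k => (c k)^* * fourier_bohr mu A f (chi k)), chi.
Qed.

Lemma eberlein_trig_approximable : trig_approximable (eberlein mu A f g).
Proof.
have [K K0 approx] := eberlein_approx => e e0.
have [m [c [chi [ch _ _ close]]]] := approx _ (divr_gt0 e0 K0).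
exists (eberlein_trig c chi); first exact: eberlein_trig_poly.
move=> t; have [_ /eberlein_trig_close] := close t.
by rewrite mulrCA divff ?mulr1// gt_eqF.
Qed.

(** Let p approximate g and let b be the coefficient of p at chi. The coefficient of g is close to
    b, and that of [f, g] is close to that of [f, p], which equals a_chi(f) conj(b); the
    approximants then disappear as e tends to 0. *)
Lemma eberlein_fourier_bohr (chi : G -> R[i]) : character chi ->
  fourier_bohr_exists mu A (eberlein mu A f g) chi /\
  fourier_bohr mu A (eberlein mu A f g) chi =
    fourier_bohr mu A f chi * (fourier_bohr mu A g chi)^*.
Proof.
move=> ch; have [_ ch1 _] := ch.
have mch := cmeasurable_conj (character_cmeasurable ch).
have [K K0 approx] := eberlein_approx.
set E := eberlein mu A f g.
have Eap : trig_approximable E := eberlein_trig_approximable.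
have mE := continuous_cmeasurable (trig_approximable_continuous Eap).
have [M EM] := trig_approximable_bounded Eap.
have mD (F : G -> R[i]) (N : R) n : cmeasurable F ->
    (forall x, normc (F x) <= N) ->
    cintegrable mu (A n) (fun s => F s * (chi s)^*) /\
    normc (average mu A (fun s => F s * (chi s)^*) n) <= 2 * N.
  move=> mF FN.
  have mFc := cmeasurableM mF mch.
  have FcN x : normc (F x * (chi x)^*) <= N.
    by rewrite normcM normc_conj ch1 mulr1.
  split; last exact: normc_average_bounded.
  exact: (cintegrable_bounded (van_hove_borel n) (van_hove_finite n) mFc FcN).
have sch : locally_sqr_integrable chi.
  apply: ess_bounded_sqr_integrable; first exact: character_cmeasurable.
  by exists 1 => //; apply: aeW => x; rewrite ch1.
(* The same [b] occurs in both halves, which is what links the coefficient of g to that of the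
   convolution. *)
have step (e : R) : 0 < e -> exists b : R[i],
    (exists2 v : nat -> R[i], v n @[n --> \oo] --> b & \forall n \near \oo,
      normc (average mu A (fun s => g s * (chi s)^*) n - v n) <= 4 * e) /\
    (exists2 v : nat -> R[i],
      v n @[n --> \oo] --> fourier_bohr mu A f chi * b^* &
      \forall n \near \oo,
        normc (average mu A (fun s => E s * (chi s)^*) n - v n) <= 2 * K * e).
  move=> e0; have [m [c [xi [cxi sh he close]]]] := approx _ e0.
  set h := (fun x => g x - _) in sh he.
  pose p x : R[i] := \sum_(k < m) c k * xi k x.
  have cvp := cvg_trig_fourier_bohr (c := c) cxi ch.
  have mp : cmeasurable p.
    by apply: continuous_cmeasurable; exact: trig_poly_continuous.
  exists (\sum_(k < m) c k * (`[< xi k = chi >]%:R : R[i])); split.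
    exists (average mu A (fun s => p s * (chi s)^*)) => //.
    apply: filterS he => n he.
    (* With weight 1 / e on h = g - p and e on chi, whose quadratic mean is 1, the bound is 2 (e +
       e) = 4 e. *)
    have ei0 : 0 < e^-1 by rewrite invr_gt0.
    have [ih hle] := average_prod_conj n ei0 sh sch.
    have [N pN] : exists N : R, forall x, normc (p x) <= N.
      by apply: trig_poly_bounded; exists m, c, xi.
    have [ip _] := mD _ _ n mp pN.
    have -> : (fun s => g s * (chi s)^*) =
        (fun s => p s * (chi s)^* + h s * (chi s)^*).
      by apply/funext => s; rewrite -mulrDl /h /p; congr (_ * _);
          rewrite [RHS]addrC subrK.
    rewrite averageD// [X in X - _]addrC addrK (le_trans hle)//.
    have -> : msq n chi = 1.
      rewrite /msq; under [X in ravg n X]eq_fun do rewrite ch1 expr1n.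
      exact: ravg_cst.
    rewrite invrK mulr1.
    have : e^-1 * msq n h <= e.
      by rewrite ler_pdivrMl// -expr2 ltW.
    lra.
  have qT := eberlein_trig_poly c cxi.
  have mq : cmeasurable (eberlein_trig c xi).
    by apply: continuous_cmeasurable; exact: trig_poly_continuous.
  exists (average mu A (fun s => eberlein_trig c xi s * (chi s)^*)).
    (* Only terms with [xi k = chi] survive, and there the coefficient of f at [xi k] is the one at
       [chi], so it comes out of the sum. *)
    have <- : \sum_(k < m) ((c k)^* * fourier_bohr mu A f (xi k)) *
        (`[< xi k = chi >]%:R : R[i]) =
        fourier_bohr mu A f chi *
          (\sum_(k < m) c k * (`[< xi k = chi >]%:R : R[i]))^*.
      rewrite rmorph_sum mulr_sumr; apply: eq_bigr => k _.
      rewrite rmorphM rmorph_nat; have [->|ne] := pselect (xi k = chi).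
        by rewrite asboolT// !mulr1 mulrC.
      by rewrite asboolF// !mulr0.
    exact: (cvg_trig_fourier_bohr
      (c := fun k => (c k)^* * fourier_bohr mu A f (xi k)) cxi ch).
  (* A uniform bound K e on the difference; averaging it against a unimodular character costs the
     factor 2. *)
  have Eq x : normc (E x - eberlein_trig c xi x) <= K * e.
    by have [_ /eberlein_trig_close] := close x.
  have [N qN] := trig_poly_bounded qT.
  apply: nearW => n.
  have [iq _] := mD _ _ n mq qN.
  have [iD] := mD _ _ n (cmeasurableB mE mq) Eq.
  rewrite mulrA; apply: le_trans.
  have -> : (fun s => E s * (chi s)^*) =
      (fun s => eberlein_trig c xi s * (chi s)^* +
        (E s - eberlein_trig c xi s) * (chi s)^*).
    by apply/funext => s; rewrite -mulrDl; congr (_ * _);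
      rewrite [RHS]addrC subrK.
  by rewrite averageD// [X in X - _]addrC addrK.
(* [fourier_bohr] is a total limit, so convergence has to be known before bounds pass to it; for g
   as well it is derived from the approximation by polynomials. *)
have gcv : cvgn (average mu A (fun s => g s * (chi s)^*)).
  apply: (@cvg_approx _ 4) => // e /step[b [[v vb gv] _]].
  by exists b; exists v.
have Ecv : cvgn (average mu A (fun s => E s * (chi s)^*)).
  apply: (@cvg_approx _ (2 * K)); first by rewrite mulr_ge0// ltW.
  move=> e /step[b [_ [v vb gv]]].
  by exists (fourier_bohr mu A f chi * b^*); exists v.
split; first by split=> // n; have [] := mD _ _ n mE EM.
apply/subr0_eq/eq0_normc/eqP; rewrite eq_le normc_ge0 andbT.
set a := fourier_bohr mu A f chi in step *.
(* The total error is 2 K e' for the convolution plus 4 |a| e' for g, where the error for g is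
   multiplied by a; hence e' = e / (2 K + 4 |a|). *)
have L0 : 0 < 2 * K + normc a * 4.
  by rewrite ltr_wpDr ?mulr_gt0// mulr_ge0 ?normc_ge0.
apply/ler_addgt0Pr => e e0; rewrite add0r.
have [b [[v vb gv] [w wb Ew]]] := step _ (divr_gt0 e0 L0).
have gb : normc (fourier_bohr mu A g chi - b) <=
    4 * (e / (2 * K + normc a * 4)).
  exact: (le_normc_limB gcv vb gv).
have Eb : normc (fourier_bohr mu A E chi - a * b^*) <=
    2 * K * (e / (2 * K + normc a * 4)).
  exact: (le_normc_limB Ecv wb Ew).
apply: (le_trans (ler_normc_dist _ (a * b^*) _)).
rewrite -mulrBr -rmorphB normcM normc_conj (normc_distC b).
apply: (@le_trans _ _ ((2 * K + normc a * 4) * (e / (2 * K + normc a * 4)))).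
  rewrite mulrDl lerD// -mulrA ler_wpM2l ?normc_ge0//.
by rewrite mulrCA divff ?mulr1// gt_eqF.
Qed.

End Main.

End VanHoveMeans.

Theorem proposition3p26 (R : realType) (G : topologicalZmodType)
    (G_hausdorff : hausdorff_space G)
    (G_locally_compact : locally_compact [set: G])
    (G_second_countable : @second_countable G)
    (mu : {measure set (borel G) -> \bar R}) (mu_haar : haar_measure mu)
    (A : nat -> set G) (A_van_hove : van_hove mu A)
    (f g : G -> R[i])
    (f_BL2 : BL2 mu A f)
    (f_fourier_bohr :
      forall chi, character chi -> fourier_bohr_exists mu A f chi)
    (g_Bap2 : Bap2 mu A g) (g_Linfty : Linfty mu g) :
  [/\ eberlein_exists mu A f g,
      SAP (eberlein mu A f g) &
      forall chi, character chi ->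
        fourier_bohr_exists mu A (eberlein mu A f g) chi /\
        fourier_bohr mu A (eberlein mu A f g) chi =
          fourier_bohr mu A f chi * (fourier_bohr mu A g chi)^*].
Proof.
split.
- exact: (eberlein_existence G_hausdorff mu_haar).
- apply: trig_approximable_SAP.
  exact: (eberlein_trig_approximable G_hausdorff mu_haar).
- move=> chi; exact: (eberlein_fourier_bohr G_hausdorff mu_haar).
Qed.
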